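(* For every nonnegative integer $n$, $$\sum_{j=0}^{\infty}pod(j)\,p(n-j)=\sum_{j=0}^{\infty}a(j)\,q_{odd}(n-j).$$
   Context: $pod(n)$ denotes the number of partitions of $n$ in which odd parts are distinct and even parts may be repeated; $p(n)$ denotes the number of (unrestricted) partitions of $n$; $a(n)$ is the cubic partition function, i.e. the number of partitions of $n$ in which the even parts can appear in two colors, with generating function $\sum_{n\ge0}a(n)q^n=\prod_{k\ge1}\frac{1}{(1-q^k)(1-q^{2k})}$; $q_{odd}(n)$ denotes the number of partitions of $n$ into distinct odd parts. Each of these functions is $1$ at $0$ and $0$ at negative arguments. *)

(* Defs.v *)
From HB Require Import structures.
From mathcomp Require Import all_boot all_order all_algebra.
From mathcomp Require Import classical_sets fsbigop.

Set Implicit Arguments.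
Unset Strict Implicit.
Unset Printing Implicit Defensive.

(* A partition of n, i.e. a multiset of positive integers with sum n, is given
   by its multiplicities: m i is the number of occurrences of the part i.+1.
   Parts and multiplicities of a partition of n never exceed n, so the bounds
   in the type lose nothing; n = 0 gives exactly the empty partition. *)
Definition partitions (n : nat) : {set {ffun 'I_n -> 'I_n.+1}} :=
  [set m : {ffun 'I_n -> 'I_n.+1} | \sum_(i < n) m i * i.+1 == n].

Definition num_part (n : nat) : nat := #|partitions n|.

Definition num_pod (n : nat) : nat :=
  #|[set m in partitions n | [forall i : 'I_n, odd i.+1 ==> (m i <= 1)]]|.

Definition num_qodd (n : nat) : nat :=
  #|[set m in partitions n |
      [forall i : 'I_n, (m i <= 1) && ((0 < m i) ==> odd i.+1)]]|.

(* Parts carry a colour in bool: m (i, c) is the number of occurrences of the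
   part i.+1 with colour c. Every part may have colour false; only even parts
   may have colour true. *)
Definition num_cubic (n : nat) : nat :=
  #|[set m : {ffun 'I_n * bool -> 'I_n.+1} |
      (\sum_(ic : 'I_n * bool) m ic * ic.1.+1 == n)
      && [forall i : 'I_n, odd i.+1 ==> (m (i, true) == 0 :> nat)]]|.

Definition ext0 (f : nat -> nat) (z : int) : nat :=
  if z is Posz k then f k else 0.

Definition pod : int -> nat := ext0 num_pod.
Definition p : int -> nat := ext0 num_part.
Definition a : int -> nat := ext0 num_cubic.
Definition q_odd : int -> nat := ext0 num_qodd.

(* Main.v *)
(* In a truncated generating function, each part size contributes one factor,
   the sum of q^(k d) over the allowed multiplicities k of the part d. The
   theorem is the factorwise identity of pod * p and a * q_odd: for odd d both
   sides are (1 + q^d) / (1 - q^d), for even d both are 1 / (1 - q^d)^2. *)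
Require Import Defs.
From mathcomp Require Import all_boot all_order all_algebra.
From mathcomp Require Import classical_sets fsbigop.

Definition mult_gf (B : nat) (A : pred nat) (d : nat) : {poly nat} :=
  (\sum_(k < B.+1 | A k) 'X^(k * d)%N)%R.

(** Distributing the product over the sums leaves one monomial for each admissible [m], of degree
    the total weight of [m]. The index type is arbitrary so that coloured parts are covered too. *)
Lemma card_multiplicities (I : finType) (B n : nat) (w : I -> nat)
    (A : I -> pred nat) :
  #|[set m : {ffun I -> 'I_B.+1} |
      (\sum_i m i * w i == n) && [forall i, A i (m i)]]|
  = ((\prod_i mult_gf B (A i) (w i))`_n)%R.
Proof.
rewrite /mult_gf bigA_distr_big_dep coef_sum -sum1dep_card.
rewrite big_mkcond [RHS]big_mkcond /=; apply: eq_bigr => m _.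
rewrite -(big_morph _ (GRing.exprD 'X%R) (GRing.expr0 _)) coefXn eq_sym.
have -> : (m \in family (fun i (k : 'I_B.+1) => A i k))
          = [forall i, A i (m i)] by [].
by case: (_ == _); case: [forall i, _].
Qed.

Definition pod_mult (d : nat) : pred nat := fun k => odd d ==> (k <= 1).

Definition qodd_mult (d : nat) : pred nat :=
  fun k => (k <= 1) && ((0 < k) ==> odd d).

Definition even_mult (d : nat) : pred nat := fun k => odd d ==> (k == 0).

(** Congruence modulo ['X^n.+1]. *)
Definition eq_upto (n : nat) (f g : {poly nat}) : Prop :=
  forall i : nat, i <= n -> (f`_i = g`_i)%R.

Lemma eq_uptoM (n : nat) (f1 f2 g1 g2 : {poly nat}) :
  eq_upto n f1 f2 -> eq_upto n g1 g2 -> eq_upto n (f1 * g1)%R (f2 * g2)%R.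
Proof.
move=> hf hg i le_in; rewrite !coefM; apply: eq_bigr => j _.
rewrite hf ?hg //; first exact: leq_trans (leq_subr _ _) le_in.
by apply: leq_trans le_in; rewrite -ltnS.
Qed.

Lemma eq_upto_prod_widen (n N : nat) (F G : nat -> {poly nat}) : n <= N ->
    (forall i, i < n -> eq_upto n (F i) (G i)) ->
    (forall i, n <= i -> eq_upto n 1%R (G i)) ->
  eq_upto n (\prod_(i < n) F i)%R (\prod_(i < N) G i)%R.
Proof.
move=> le_nN hF hG; rewrite (big_ord_widen _ F le_nN) big_mkcond /=.
apply: (big_ind2 (eq_upto n)) => // [*|i _]; first exact: eq_uptoM.
by case: ltnP => [/hF|/hG].
Qed.

Lemma coef_mult_gf (B : nat) (A : pred nat) (d i : nat) :
  ((mult_gf B A d)`_i)%R = \sum_(k < B.+1 | A k) (i == k * d).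
Proof. by rewrite coef_sum; apply: eq_bigr => k _; rewrite coefXn; case: eqP. Qed.

(** The additional terms have [k > n], hence degree [k * d > n]. *)
Lemma eq_upto_mult_gf (n N : nat) (A : pred nat) (d : nat) : n <= N -> 0 < d ->
  eq_upto n (mult_gf n A d) (mult_gf N A d).
Proof.
move=> le_nN d_gt0 i le_in; rewrite !coef_mult_gf.
rewrite (big_ord_widen_cond _ A (fun k => (i == k * d) : nat) (_ : n < N.+1)) //.
rewrite [RHS](bigID (fun k : 'I__ => k < n.+1)) /= [X in _ = _ + X]big1 ?addn0 //.
move=> k /andP[_]; rewrite -leqNgt => lt_nk.
case: eqP => // eq_i; move: (leq_trans lt_nk (leq_pmulr k d_gt0)).
by rewrite -eq_i ltnNge le_in.
Qed.

(** A part larger than [n] can only occur zero times: every term with [k > 0] has degree at least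
    [d]. *)
Lemma eq_upto_mult_gf1 (n N : nat) (A : pred nat) (d : nat) : A 0 -> n < d ->
  eq_upto n 1%R (mult_gf N A d).
Proof.
move=> A0 lt_nd i le_in; rewrite coef_mult_gf (bigD1 ord0) //= mul0n.
rewrite big1 ?addn0 => [|k /andP[_ k_neq0]]; first by rewrite coef1; case: eqP.
have k_gt0 : 0 < k by rewrite lt0n.
case: eqP => // eq_i; move: (leq_trans lt_nd (leq_pmull d k_gt0)).
by rewrite -eq_i ltnNge le_in.
Qed.

(** The type of [partitions n] changes with [n], whereas a convolution needs one polynomial for all
    indices at once. Hence the separate bound [N], which limits both part sizes and
    multiplicities. *)
Lemma coef_partition_gf (A : nat -> pred nat) (n N : nat) :
    n <= N -> (forall i, A i 0) ->
  #|[set m in partitions n | [forall i : 'I_n, A i (m i)]]|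
  = ((\prod_(i < N) mult_gf N (A i) i.+1)`_n)%R.
Proof.
move=> le_nN A0.
transitivity ((\prod_(i < n) mult_gf n (A i) i.+1)`_n)%R.
  rewrite -(card_multiplicities 'I_n n n (fun i : 'I_n => i.+1) (fun i : 'I_n => A i)).
  by apply: eq_card => m; rewrite !inE.
pose F B i := mult_gf B (A i) i.+1.
apply: (eq_upto_prod_widen n N (F n) (F N)) => // i hi.
  exact: eq_upto_mult_gf.
exact: eq_upto_mult_gf1.
Qed.

Lemma num_pod_gf (n N : nat) : n <= N ->
  num_pod n = ((\prod_(i < N) mult_gf N (pod_mult i.+1) i.+1)`_n)%R.
Proof.
move=> le_nN; apply: (coef_partition_gf (fun i => pod_mult i.+1)) => // i.
exact: implybT.
Qed.

Lemma num_qodd_gf (n N : nat) : n <= N ->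
  num_qodd n = ((\prod_(i < N) mult_gf N (qodd_mult i.+1) i.+1)`_n)%R.
Proof.
by move=> le_nN; apply: (coef_partition_gf (fun i => qodd_mult i.+1)).
Qed.

Lemma num_part_gf (n N : nat) : n <= N ->
  num_part n = ((\prod_(i < N) mult_gf N xpredT i.+1)`_n)%R.
Proof.
move=> le_nN; rewrite -(coef_partition_gf (fun=> xpredT)) //.
apply: eq_card => m; rewrite !inE.
have -> : [forall i : 'I_n, true] by apply/forallP.
by rewrite andbT.
Qed.

Lemma num_cubic_gf (n N : nat) : n <= N ->
  num_cubic n
  = ((\prod_(i < N) (mult_gf N xpredT i.+1
        * mult_gf N (even_mult i.+1) i.+1))`_n)%R.
Proof.
move=> le_nN.
(* Colour [false] is unrestricted; colour [true] must avoid odd parts. The product over pairs then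
   splits into two factors per part size. *)
pose A (ic : 'I_n * bool) k := ic.2 ==> even_mult ic.1.+1 k.
transitivity ((\prod_ic mult_gf n (A ic) ic.1.+1)`_n)%R.
  rewrite -card_multiplicities; apply: eq_card => m; rewrite !inE.
  congr (_ && _); apply/forallP/forallP => [h [i []] | h i] //.
    exact: h.
  exact: (h (i, true)).
rewrite -(pair_bigA _ (fun i c => mult_gf n (A (i, c)) i.+1)) /=.
under eq_bigr do rewrite big_bool /= GRing.mulrC.
pose F B i := (mult_gf B xpredT i.+1
  * mult_gf B (even_mult i.+1) i.+1)%R.
apply: (eq_upto_prod_widen n N (F n) (F N)) => // i hi.
  by apply: eq_uptoM; apply: eq_upto_mult_gf.
rewrite -[1%R]GRing.mul1r.
by apply: eq_uptoM; apply: eq_upto_mult_gf1; rewrite // /even_mult implybT.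
Qed.

Lemma eq_mult_gf (B : nat) (A1 A2 : pred nat) (d : nat) :
  A1 =1 A2 -> mult_gf B A1 d = mult_gf B A2 d.
Proof. by move=> eqA; apply: eq_bigl => k; apply: eqA. Qed.

(** The identity is exact even after truncation. For an odd part, [even_mult] leaves only [k = 0], a
    factor 1, while [pod_mult] and [qodd_mult] both mean [k <= 1]. For an even part, [qodd_mult]
    leaves only [k = 0] and the other conditions are vacuous. *)
Lemma mult_gf_factor (B i : nat) :
  (mult_gf B (pod_mult i.+1) i.+1 * mult_gf B xpredT i.+1
   = mult_gf B xpredT i.+1 * mult_gf B (even_mult i.+1) i.+1
     * mult_gf B (qodd_mult i.+1) i.+1)%R.
Proof.
have eq0_gf : mult_gf B (fun k => k == 0) i.+1 = 1%R.
  by rewrite /mult_gf (big_pred1 ord0).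
rewrite /pod_mult /even_mult /qodd_mult; case: (odd i.+1) => /=.
  rewrite eq0_gf GRing.mulr1 GRing.mulrC; congr (_ * _)%R.
  by apply: eq_mult_gf => k; rewrite implybT andbT.
rewrite (eq_mult_gf _ (fun k => (k <= 1) && _) (fun k => k == 0)).
  by rewrite eq0_gf GRing.mulr1.
by case=> [|[]].
Qed.

Lemma convolution_fsbig (f g : nat -> nat) (F G : {poly nat}) (n : nat) :
    (forall j, j <= n -> f j = (F`_j)%R) ->
    (forall j, j <= n -> g j = (G`_j)%R) ->
  \big[addn/0]_(j \in [set: nat]%classic)
     (ext0 f j%:Z * ext0 g (n%:Z - j%:Z)%R) = ((F * G)`_n)%R.
Proof.
move=> hf hg; rewrite coefM.
rewrite -(@fsbig_widen _ _ _ _ `I_n.+1%classic) //.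
  rewrite -(@fsbig_ord _ _ _ n.+1
    (fun j => ext0 f j%:Z * ext0 g (n%:Z - j%:Z)%R)).
  apply: eq_bigr => j _; have le_jn : j <= n by rewrite -ltnS.
  by rewrite subzn //= hf ?hg ?leq_subr.
(* For [j > n] the argument [n - j] is a negative integer, where [ext0] returns 0; so the infinite
   sum is the finite Cauchy product. *)
move=> j [_ /negP]; rewrite /= -leqNgt => lt_nj.
rewrite -GRing.opprB subzn ?(ltnW lt_nj) //.
by move: lt_nj; rewrite -subn_gt0; case: (j - n) => // m _; rewrite muln0.
Qed.

Theorem theorem4p18 (n : nat) :
  (\big[addn/0%N]_(j \in [set: nat]%classic) (pod j%:Z * p (n%:Z - j%:Z)%R)%N
   = \big[addn/0%N]_(j \in [set: nat]%classic)
       (a j%:Z * q_odd (n%:Z - j%:Z)%R)%N)%N.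
Proof.
(* The truncation bound stays at [n] for every index [j <= n]. *)
rewrite (convolution_fsbig _ _ _ _ n (fun j => num_pod_gf j n)
  (fun j => num_part_gf j n)).
rewrite (convolution_fsbig _ _ _ _ n (fun j => num_cubic_gf j n)
  (fun j => num_qodd_gf j n)).
by rewrite -!big_split /=; under eq_bigr do rewrite mult_gf_factor.
Qed.
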